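(* Let $(X,M,\ast)$ be a complete fuzzy metric space with $X$ nonempty, let $f,g\colon X\to X$ be two mappings, and let $\varphi\in\Phi$. Suppose that $g$ is bijective and that $f$ is a fuzzy $(g,\varphi)$-contraction with respect to this $g$, i.e. for every $x,y\in X$ and every $t>0$, $$M(gx,gy,t)>1-t\ \Longrightarrow\ M(fx,fy,\varphi(t))>1-\varphi(t).$$ Then there exists a unique coincidence point of $f$ and $g$, i.e. a unique $z\in X$ such that $gz=fz$.
   Context: A continuous $t$-norm is a binary operation $\ast\colon[0,1]\times[0,1]\to[0,1]$ such that $([0,1],\ast)$ is a topological monoid (i.e. $\ast$ is associative and continuous) with unit $1$, and $a\ast b\le c\ast d$ whenever $a\le c$ and $b\le d$. A fuzzy metric space is a triple $(X,M,\ast)$ where $X$ is a set, $\ast$ is a continuous $t$-norm and $M\colon X\times X\times[0,+\infty)\to[0,1]$ satisfies, for all $x,y,z\in X$ and $s,t>0$: (FM1) $M(x,y,0)=0$; (FM2) $M(x,y,t)>0$; (FM3) $M(x,y,t)=1$ if and only if $x=y$; (FM4) $M(x,y,t)=M(y,x,t)$; (FM5) $M(x,z,t+s)\ge M(x,y,t)\ast M(y,z,s)$; (FM6) $M(x,y,\cdot)\colon(0,+\infty)\to[0,1]$ is continuous. A sequence $\{x_n\}$ in $X$ converges to $x\in X$ if $\lim_{n\to\infty}M(x_n,x,t)=1$ for all $t>0$. It is a fuzzy Cauchy sequence if for every $t>0$ one has $M(x_m,x_n,t)\to1$ as $m,n\to\infty$. The space is complete if every fuzzy Cauchy sequence converges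 to a point of $X$. $\Phi$ is the class of all mappings $\varphi\colon[0,+\infty)\to[0,+\infty)$ that are nondecreasing, right continuous, and satisfy $\lim_{n\to+\infty}\varphi^n(t)=0$ for every $t>0$, where $\varphi^n$ is the $n$-fold iterate. *)

(* Defs.v *)
From HB Require Import structures.
From mathcomp Require Import all_boot all_order all_algebra.
From mathcomp Require Import all_classical all_reals all_analysis.

Set Implicit Arguments.
Unset Strict Implicit.
Unset Printing Implicit Defensive.

Import Order.TTheory GRing.Theory Num.Theory.
Import numFieldNormedType.Exports.

Local Open Scope classical_set_scope.
Local Open Scope ring_scope.

(** Maps whose domain or codomain is [0, 1] or [0, +oo) are
    represented by total functions on [R]; every condition is restricted to the
    intended domain, so the values taken outside of it are irrelevant. *)

(** Commutativity is not an axiom: a continuous t-norm is here a topological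
    monoid on [0, 1] with unit 1 and monotone multiplication. *)
Record continuous_tnorm (R : realType) (star : R -> R -> R) : Prop := {
  tnorm_closed : {in `[0, 1] &, forall a b, star a b \in `[0, 1]} ;
  tnormA : {in `[0, 1] & &, forall a b c,
    star a (star b c) = star (star a b) c} ;
  tnorm1l : {in `[0, 1], forall a, star 1 a = a} ;
  tnorm1r : {in `[0, 1], forall a, star a 1 = a} ;
  tnorm_continuous : {within `[0, 1] `*` `[0, 1],
    continuous (fun p : R * R => star p.1 p.2)} ;
  tnorm_homo : forall a b c d,
    a \in `[0, 1] -> b \in `[0, 1] -> c \in `[0, 1] -> d \in `[0, 1] ->
    a <= c -> b <= d -> star a b <= star c d }.

Record fuzzy_metric_space (R : realType) (X : Type) (M : X -> X -> R -> R)
    (star : R -> R -> R) : Prop := {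
  fm_tnorm : continuous_tnorm star ;
  fm_range : forall x y t, 0 <= t -> M x y t \in `[0, 1] ;
  fm_0 : forall x y, M x y 0 = 0 ;
  fm_gt0 : forall x y t, 0 < t -> 0 < M x y t ;
  fm_eq1 : forall x y t, 0 < t -> (M x y t = 1 <-> x = y) ;
  fm_sym : forall x y t, 0 < t -> M x y t = M y x t ;
  fm_triangle : forall x y z s t, 0 < s -> 0 < t ->
    star (M x y t) (M y z s) <= M x z (t + s) ;
  fm_continuous : forall x y, {within `]0, +oo[, continuous (M x y)} }.

Section Convergence.
Context (R : realType) (X : Type) (M : X -> X -> R -> R).

Definition fuzzy_cvg (u : nat -> X) (x : X) : Prop :=
  forall t : R, 0 < t -> M (u n) x t @[n --> \oo] --> (1 : R).

Definition fuzzy_cauchy (u : nat -> X) : Prop :=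
  forall t : R, 0 < t -> M (u mn.1) (u mn.2) t @[mn --> (\oo, \oo)] --> (1 : R).

Definition fuzzy_complete : Prop :=
  forall u : nat -> X, fuzzy_cauchy u -> exists x, fuzzy_cvg u x.

Definition fuzzy_contraction (g : X -> X) (phi : R -> R) (f : X -> X) : Prop :=
  forall x y t, 0 < t ->
    1 - t < M (g x) (g y) t -> 1 - phi t < M (f x) (f y) (phi t).

End Convergence.

Record class_Phi (R : realType) (phi : R -> R) : Prop := {
  Phi_ge0 : forall t, 0 <= t -> 0 <= phi t ;
  Phi_homo : forall s t, 0 <= s -> s <= t -> phi s <= phi t ;
  Phi_right_continuous : forall t, 0 <= t -> phi s @[s --> t^'+] --> phi t ;
  Phi_iter : forall t, 0 < t -> iter n phi t @[n --> \oo] --> (0 : R) }.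

(* Main.v *)
Require Import Defs.
From mathcomp Require Import all_boot all_order all_algebra.
From mathcomp Require Import all_classical all_reals all_analysis.

(** Put [T = f \o g^-1], so that coincidence points of [f] and [g] correspond to
    fixed points of [T], and [M x y t > 1 - t] implies
    [M (T x) (T y) (phi t) > 1 - phi t]. Since [M x y 2 >= 0 > 1 - 2] for all
    [x] and [y], iterating gives [M (T^n x) (T^n y) r > 1 - r] with
    [r = phi^n 2], uniformly in [x] and [y]. As [phi^n 2] tends to 0, all orbits
    are Cauchy, fixed points are unique, and [T] preserves limits. *)

Set Implicit Arguments.
Unset Strict Implicit.
Unset Printing Implicit Defensive.

Import Order.TTheory GRing.Theory Num.Theory.
Import numFieldNormedType.Exports.

Local Open Scope classical_set_scope.
Local Open Scope ring_scope.

(** Continuity of [star] at [(1, 1)], where its value is 1; it holds only relative to the unit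
    square, hence the range conditions on [u] and [v]. *)
Lemma tnorm_cvg1 (R : realType) (star : R -> R -> R) (T : Type)
    (F : set_system T) (u v : T -> R) : Filter F -> continuous_tnorm star ->
    (forall i, u i \in `[0, 1]) -> (forall i, v i \in `[0, 1]) ->
  u @ F --> (1 : R) -> v @ F --> (1 : R) ->
  (fun i => star (u i) (v i)) @ F --> (1 : R).
Proof.
move=> FF hs u01 v01 cu cv.
have one01 : (1 : R) \in `[0, 1] by rewrite in_itv /= ler01 lexx.
have /subspace_continuousP/(_ (1, 1)) := tnorm_continuous hs.
rewrite /from_subspace /= (tnorm1l hs)// => /(_ (conj one01 one01)).
apply: (@cvg_comp _ _ _ (fun i => (u i, v i)) _ F).
move=> A /(cvg_pair cu cv); rewrite !near_simpl /=.
by apply: filterS => i; apply; split; [exact: u01|exact: v01].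
Qed.

Section FuzzyMetric.
Context (R : realType) (X : Type) (M : X -> X -> R -> R) (star : R -> R -> R).
Context (hM : fuzzy_metric_space M star).

Lemma fm_refl x t : 0 < t -> M x x t = 1.
Proof. by move=> t0; apply/(fm_eq1 hM). Qed.

Lemma fm_le1 x y t : 0 <= t -> M x y t <= 1.
Proof. by move=> /(fm_range hM x y); rewrite in_itv /= => /andP[]. Qed.

(** Triangle inequality from [x] to [y] through [y] itself: the remaining time [t - s] contributes
    [M y y (t - s) = 1], the unit of [star]. *)
Lemma fm_homo x y s t : 0 < s -> s <= t -> M x y s <= M x y t.
Proof.
move=> s0; rewrite le_eqVlt => /predU1P[->//|st].
have ts0 : 0 < t - s by rewrite subr_gt0.
have := fm_triangle hM x y y ts0 s0.
rewrite fm_refl// (tnorm1r (fm_tnorm hM)); last exact/(fm_range hM)/ltW.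
by rewrite addrC subrK.
Qed.

Lemma fm_gt1B_le x y s t e : 0 < s -> s <= t -> s <= e ->
  1 - s < M x y s -> 1 - e < M x y t.
Proof.
move=> s0 st se h; apply: (lt_le_trans _ (fm_homo x y s0 st)).
by apply: le_lt_trans h; rewrite lerD2l lerN2.
Qed.

Lemma fm_cvg1 (T : Type) (F : set_system T) (x y : T -> X) t : Filter F ->
    0 < t -> (forall e, 0 < e -> \forall i \near F, 1 - e < M (x i) (y i) t) ->
  M (x i) (y i) t @[i --> F] --> (1 : R).
Proof.
move=> FF t0 h; apply/cvgrPdist_lt => e e0; near=> i.
rewrite ger0_norm ?subr_ge0 ?fm_le1 ?ltW// ltrBlDl -ltrBlDr.
by near: i; exact: h.
Unshelve. all: by end_near. Qed.

Lemma fuzzy_cvg_unique (u : nat -> X) x y :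
  fuzzy_cvg M u x -> fuzzy_cvg M u y -> x = y.
Proof.
move=> ux uy; apply/(fm_eq1 hM x y (@ltr01 R)).
have h0 : 0 < 2^-1 :> R by rewrite invr_gt0 ltr0n.
have Mux n : M x (u n) 2^-1 = M (u n) x 2^-1 by exact: (fm_sym hM).
apply/eqP; rewrite eq_le fm_le1//=.
have c : star (M (u n) x 2^-1) (M (u n) y 2^-1) @[n --> \oo] --> (1 : R).
  apply: tnorm_cvg1; [exact: (fm_tnorm hM)| | |exact: ux|exact: uy].
    by move=> n; exact/(fm_range hM)/ltW.
  by move=> n; exact/(fm_range hM)/ltW.
(* By the triangle inequality through [u n] with time 1 split into halves, [M x y 1] bounds from
   above a sequence tending to 1. *)
apply: (cvgr_to_le c); near=> n.
have half2 : 2^-1 + 2^-1 = 1 :> R by rewrite [RHS]splitr mul1r.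
by rewrite -Mux -[in leRHS]half2 (fm_triangle hM).
Unshelve. all: by end_near. Qed.

Section FixedPoint.
Context (T : X -> X) (phi : R -> R).
Context (hphi : class_Phi phi) (hT : fuzzy_contraction M id phi T).

(* If [phi t = 0], the contraction property at two equal points would give
   [M (T x) (T x) 0 > 1], contradicting (FM1). *)
Lemma contraction_phi_gt0 (x : X) (t : R) : 0 < t -> 0 < phi t.
Proof.
move=> t0; rewrite lt_neqAle (Phi_ge0 hphi) ?ltW// andbT; apply/eqP => p0.
have := @hT x x t t0; rewrite fm_refl// -p0 (fm_0 hM) subr0 ltr10.
by rewrite ltrBlDr ltrDl t0 => /(_ isT).
Qed.

Lemma contraction_iter_gt0 (x : X) n : 0 < iter n phi 2.
Proof. by elim: n => [|n IH] /=; [exact: ltr0n|exact: contraction_phi_gt0]. Qed.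

Lemma contraction_iter x y n :
  1 - iter n phi 2 < M (iter n T x) (iter n T y) (iter n phi 2).
Proof.
elim: n => [|n IH] /=; last exact: hT (contraction_iter_gt0 x n) IH.
have /(fm_range hM x y) : 0 <= 2 :> R by [].
by rewrite in_itv /= => /andP[+ _]; apply: lt_le_trans; rewrite subr_lt0 ltr1n.
Qed.

Lemma contraction_iter_small (e : R) : 0 < e ->
  exists n, iter n phi 2 <= e.
Proof.
move=> e0.
have /cvgrPdist_le/(_ _ e0)[n _ /(_ _ (leqnn n))] := Phi_iter hphi (@ltr0n R 2).
by rewrite /= sub0r normrN => /(le_trans (ler_norm _)); exists n.
Qed.

Lemma contraction_iter_near t e : 0 < t -> 0 < e ->
  exists n, forall x y, 1 - e < M (iter n T x) (iter n T y) t.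
Proof.
move=> t0 e0; have /contraction_iter_small[n] : 0 < Num.min t e.
  by rewrite lt_min t0.
rewrite le_min => /andP[nt ne]; exists n => x y.
exact: fm_gt1B_le (contraction_iter_gt0 x n) nt ne (contraction_iter _ _ _).
Qed.

Lemma contraction_orbit_cauchy x : fuzzy_cauchy M (fun n => iter n T x).
Proof.
move=> t t0; apply: fm_cvg1 => // e e0.
have [n hn] := contraction_iter_near t0 e0.
exists ([set k | (n <= k)%N], [set k | (n <= k)%N]) => /=.
  by split; exact: nbhs_infty_ge.
(* Beyond index [n], both terms are [n]-th iterates of points of the orbit, so the bound uniform in
   the two points applies. *)
by move=> [i j] /= [ni nj]; rewrite -(subnKC ni) -(subnKC nj) !iterD.
Qed.

(** For a small scale [r], eventually [M (u k) x r > 1 - r]; one contraction step gives the bound at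
    [phi r], which is at most [t] and [e]. *)
Lemma contraction_cvg (u : nat -> X) x :
  fuzzy_cvg M u x -> fuzzy_cvg M (T \o u) (T x).
Proof.
move=> ux t t0; apply: fm_cvg1 => // e e0.
have /contraction_iter_small[n] : 0 < Num.min t e by rewrite lt_min t0.
rewrite le_min => /andP[nt ne].
set r := iter n phi 2 in nt ne.
have r0 : 0 < r by exact: contraction_iter_gt0.
(* If [r < phi r], monotonicity keeps all iterates of [phi] at [r] above [r], so they cannot tend to
   0. *)
have rr : phi r <= r.
  rewrite leNgt; apply/negP => rr.
  have it k : r <= iter k phi r.
    elim: k => [|k IH] //=; apply: (le_trans (ltW rr)).
    exact: (Phi_homo hphi (ltW r0)).
  suff : r <= 0 by rewrite leNgt r0.
  exact: (cvgr_to_ge (Phi_iter hphi r0) (nearW _ it)).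
near=> k; apply: (@fm_gt1B_le _ _ (phi r)).
- exact: contraction_phi_gt0.
- exact: le_trans rr nt.
- exact: le_trans rr ne.
- apply: hT => //; near: k.
  by apply: (cvgr_gt _ (ux r r0)); rewrite ltrBlDr ltrDl.
Unshelve. all: by end_near. Qed.

Lemma contraction_fixpoint_unique x y : T x = x -> T y = y -> x = y.
Proof.
(* The constant sequence [x] also converges to [y], since every iterate of [T] fixes both points. *)
move=> Tx Ty; apply: (@fuzzy_cvg_unique (fun=> x)) => t t0.
  by apply: fm_cvg1 => // e e0; near=> n; rewrite fm_refl// ltrBlDr ltrDl.
apply: fm_cvg1 => // e e0; near=> k.
have [n /(_ x y)] := contraction_iter_near t0 e0.
by rewrite !iter_fix.
Unshelve. all: by end_near. Qed.

Lemma contraction_fixpoint : inhabited X -> fuzzy_complete M ->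
  exists x, T x = x.
Proof.
move=> [x0] /(_ _ (contraction_orbit_cauchy x0))[x ux]; exists x.
apply: fuzzy_cvg_unique (contraction_cvg ux) _ => t t0.
(* The image of the orbit under [T] is the orbit shifted by one, so its limit is [x] as well as
   [T x]. *)
have := ux t t0; rewrite -(cvg_shiftS (fun n => M (iter n T x0) x t)).
exact.
Qed.

End FixedPoint.
End FuzzyMetric.

Theorem theorem17 (R : realType) (X : Type) (M : X -> X -> R -> R)
    (star : R -> R -> R) (f g : X -> X) (phi : R -> R)
    (hX : inhabited X)
    (hM : fuzzy_metric_space M star)
    (hcomplete : fuzzy_complete M)
    (hphi : class_Phi phi)
    (hg : bijective g)
    (hf : fuzzy_contraction M g phi f) :
  exists! z : X, g z = f z.
Proof.
case: hg => h gK hK.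
have hT : fuzzy_contraction M id phi (f \o h).
  by move=> x y t t0 xy; apply: hf => //; rewrite !hK.
have [x Tx] := contraction_fixpoint hM hphi hT hX hcomplete.
exists (h x); split=> [|z gz]; first by rewrite hK.
apply: (can_inj gK); rewrite hK.
(* [g z] is fixed by [f \o h], because [f (h (g z)) = f z = g z]. *)
by apply: (contraction_fixpoint_unique hM hphi hT) => //=; rewrite gK.
Qed.
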